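(* Consider the binary random graph affiliation mixture model with $Q\ge1$ groups, all $\pi_q>0$, and $\alpha\ne\beta$. Let $m_1=\mathbb E(X_{12})$, $m_2=\mathbb E(X_{12}X_{13})$, $m_3=\mathbb E(X_{12}X_{13}X_{23})$. Then $$2m_1^3-3m_1m_2+m_3=0\quad\text{if and only if}\quad Q=1.$$
   Context: Random graph mixture model: nodes have i.i.d. latent groups $Z_i\in\{1,\dots,Q\}$ with $\pi_q=\mathbb P(Z_i=q)$, $\sum_q\pi_q=1$; edge variables $X_{ij}$ ($i<j$) are conditionally independent given all $Z$'s, with law of $X_{ij}$ depending only on $(Z_i,Z_j)$. Binary affiliation model: $X_{ij}\in\{0,1\}$ with $\mathbb P(X_{ij}=1\mid Z_i=q,Z_j=l)=\alpha$ if $q=l$ and $=\beta$ if $q\ne l$ (when $Q=1$ only $\alpha$ is used). *)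

(* Defs.v *)
From HB Require Import structures.
From mathcomp Require Import all_boot all_order all_algebra.
Set Implicit Arguments. Unset Strict Implicit. Unset Printing Implicit Defensive.
Import Order.TTheory GRing.Theory Num.Theory.
Local Open Scope ring_scope.

Definition aff_prob (R : ringType) (Q : nat) (alpha beta : R) (q l : 'I_Q) : R :=
  if q == l then alpha else beta.

(* Moments of the mixture, obtained by conditioning on the i.i.d. latent
   groups Z_1, Z_2, Z_3 (edges conditionally independent given Z). *)
Definition mom1 (R : ringType) (Q : nat) (pi : 'I_Q -> R) (alpha beta : R) : R :=
  \sum_(q < Q) \sum_(l < Q) pi q * pi l * aff_prob alpha beta q l.

Definition mom2 (R : ringType) (Q : nat) (pi : 'I_Q -> R) (alpha beta : R) : R :=
  \sum_(q < Q) \sum_(l < Q) \sum_(r < Q)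
    pi q * pi l * pi r * (aff_prob alpha beta q l * aff_prob alpha beta q r).

Definition mom3 (R : ringType) (Q : nat) (pi : 'I_Q -> R) (alpha beta : R) : R :=
  \sum_(q < Q) \sum_(l < Q) \sum_(r < Q)
    pi q * pi l * pi r *
    (aff_prob alpha beta q l * aff_prob alpha beta q r * aff_prob alpha beta l r).

(* Main.v *)
(* Writing delta = alpha - beta and s_k = sum_q pi_q^k, conditioning on one endpoint
   collapses every inner sum: sum_l pi_l aff(q,l) g(l) = beta sum_l pi_l g(l) + delta pi_q g(q).
   Hence the three moments are polynomials in beta, delta, s_2, s_3, and
   2 m1^3 - 3 m1 m2 + m3 = delta^3 (2 s_2^3 - 3 s_2 s_3 + s_3).
   For Q = 1 we have s_2 = s_3 = 1 and the bracket vanishes. For Q >= 2 the power sums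
   satisfy s_3^2 < s_2^3 (bound s_3 by max pi * s_2 and note (max pi)^2 < s_2), and
   2u^3 - 3uv + v > 0 whenever 0 <= v and v^2 < u^3. *)
Require Import Defs.
From HB Require Import structures.
From mathcomp Require Import all_boot all_order all_algebra.
From mathcomp Require Import ring lra.
Set Implicit Arguments.
Unset Strict Implicit.
Unset Printing Implicit Defensive.
Import Order.TTheory GRing.Theory Num.Theory.
Local Open Scope ring_scope.

Section AffiliationMoments.
Variables (R : comNzRingType) (Q : nat) (pi : 'I_Q -> R) (alpha beta : R).
Local Notation aff := (aff_prob alpha beta).
Local Notation s2 := (\sum_(q < Q) pi q ^+ 2).
Local Notation s3 := (\sum_(q < Q) pi q ^+ 3).

Lemma aff_probC (q l : 'I_Q) : aff q l = aff l q.
Proof. by rewrite /aff_prob eq_sym. Qed.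

Lemma sum_aff_prob (q : 'I_Q) (g : 'I_Q -> R) :
  \sum_(l < Q) pi l * aff q l * g l
  = beta * \sum_(l < Q) pi l * g l + (alpha - beta) * pi q * g q.
Proof.
rewrite (bigD1 q) //= [in RHS](bigD1 q) //= /aff_prob eqxx mulrDr.
rewrite mulr_sumr (eq_bigr (fun l => beta * (pi l * g l))); first by ring.
by move=> l /negbTE; rewrite eq_sym => ->; ring.
Qed.

Hypothesis pi_sum1 : \sum_(q < Q) pi q = 1.

Lemma sum_pi_aff (q : 'I_Q) :
  \sum_(l < Q) pi l * aff q l = beta + (alpha - beta) * pi q.
Proof.
transitivity (\sum_(l < Q) pi l * aff q l * 1); first by apply: eq_bigr => l _; rewrite mulr1.
by rewrite sum_aff_prob (eq_bigr _ (fun l _ => mulr1 (pi l))) pi_sum1 !mulr1.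
Qed.

Lemma sum_pi_quadratic (a b c : R) :
  \sum_(q < Q) pi q * (a + b * pi q + c * pi q ^+ 2) = a + b * s2 + c * s3.
Proof.
transitivity (\sum_(q < Q) (a * pi q + b * pi q ^+ 2 + c * pi q ^+ 3)).
  by apply: eq_bigr => q _; ring.
by rewrite !big_split -!mulr_sumr pi_sum1 mulr1.
Qed.

Lemma mom1E : mom1 pi alpha beta = beta + (alpha - beta) * s2.
Proof.
rewrite /mom1; transitivity (\sum_(q < Q) pi q * (beta + (alpha - beta) * pi q + 0 * pi q ^+ 2)).
  apply: eq_bigr => q _; rewrite mul0r addr0 -sum_pi_aff mulr_sumr.
  by apply: eq_bigr => l _; rewrite mulrA.
by rewrite sum_pi_quadratic mul0r addr0.
Qed.

Lemma mom2E : mom2 pi alpha beta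
  = beta ^+ 2 + 2 * beta * (alpha - beta) * s2 + (alpha - beta) ^+ 2 * s3.
Proof.
rewrite /mom2 -sum_pi_quadratic; apply: eq_bigr => q _.
transitivity (pi q * (\sum_(l < Q) pi l * aff q l) ^+ 2); last by rewrite sum_pi_aff; ring.
rewrite expr2 mulrA [pi q * _]mulr_sumr big_distrl /=; apply: eq_bigr => l _.
by rewrite mulr_sumr; apply: eq_bigr => r _; ring.
Qed.

Lemma mom3E : mom3 pi alpha beta = beta ^+ 3 + 3 * beta ^+ 2 * (alpha - beta) * s2
  + (3 * beta * (alpha - beta) ^+ 2 + (alpha - beta) ^+ 3) * s3.
Proof.
rewrite /mom3; transitivity (\sum_(q < Q) pi q * ((beta ^+ 3 + beta ^+ 2 * (alpha - beta) * s2)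
    + 2 * beta ^+ 2 * (alpha - beta) * pi q
    + (2 * beta * (alpha - beta) ^+ 2 + (alpha - beta) ^+ 2 * alpha) * pi q ^+ 2));
  last by rewrite sum_pi_quadratic; ring.
apply: eq_bigr => q _.
have inner l : \sum_(r < Q) pi r * aff q r * aff l r
    = beta * (beta + (alpha - beta) * pi l) + (alpha - beta) * pi q * aff q l.
  by rewrite sum_aff_prob sum_pi_aff aff_probC.
have outer : \sum_(l < Q) pi l * (beta * (beta + (alpha - beta) * pi l)
                                   + (alpha - beta) * pi q * aff q l)
    = beta ^+ 2 + beta * (alpha - beta) * s2 + (alpha - beta) * pi q * (beta + (alpha - beta) * pi q).
  transitivity (\sum_(l < Q) (beta ^+ 2 * pi l + beta * (alpha - beta) * pi l ^+ 2
                             + (alpha - beta) * pi q * (pi l * aff q l))).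
    by apply: eq_bigr => l _; ring.
  by rewrite !big_split -!mulr_sumr pi_sum1 sum_pi_aff mulr1.
transitivity (pi q * \sum_(l < Q) pi l * aff q l * \sum_(r < Q) pi r * aff q r * aff l r).
  rewrite mulr_sumr; apply: eq_bigr => l _.
  by rewrite !mulr_sumr; apply: eq_bigr => r _; ring.
under eq_bigr do rewrite inner.
by rewrite sum_aff_prob outer /aff_prob eqxx; ring.
Qed.

Lemma affiliation_moment_identity :
  2 * mom1 pi alpha beta ^+ 3 - 3 * mom1 pi alpha beta * mom2 pi alpha beta
    + mom3 pi alpha beta
  = (alpha - beta) ^+ 3 * (2 * s2 ^+ 3 - 3 * s2 * s3 + s3).
Proof. by rewrite mom1E mom2E mom3E; ring. Qed.

End AffiliationMoments.

Lemma sum_cube_sqr_lt (R : realFieldType) (I : finType) (x : I -> R) :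
  (1 < #|I|)%N -> (forall i, 0 < x i) ->
  (\sum_i x i ^+ 3) ^+ 2 < (\sum_i x i ^+ 2) ^+ 3.
Proof.
move=> /card_gt1P[i [j [_ _ ij]]] x_gt0.
have [m _ x_le_m] := @arg_maxP _ R _ i predT x isT.
have [k km] : exists k, k != m.
  by case: (eqVneq i m) => [<-|im]; [exists j; rewrite eq_sym | exists i].
have s3_le : \sum_i x i ^+ 3 <= x m * \sum_i x i ^+ 2.
  rewrite mulr_sumr; apply: ler_sum => l _.
  by rewrite exprSr [x m * _]mulrC; apply: ler_wpM2l; [exact: sqr_ge0 | exact: x_le_m].
have m2_lt : x m ^+ 2 < \sum_i x i ^+ 2.
  rewrite (bigD1 m) //= ltrDl (bigD1 k) //=.
  apply: (lt_le_trans (exprn_gt0 2 (x_gt0 k))).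
  by rewrite lerDl sumr_ge0 // => l _; rewrite exprn_ge0 ?ltW.
have s2_gt0 : 0 < \sum_i x i ^+ 2 := le_lt_trans (sqr_ge0 _) m2_lt.
have s3_ge0 : 0 <= \sum_i x i ^+ 3 by rewrite sumr_ge0 // => l _; rewrite exprn_ge0 ?ltW.
apply: (le_lt_trans (y := (x m * \sum_i x i ^+ 2) ^+ 2)).
  by rewrite !expr2 ler_pM.
by rewrite exprMn (exprSr _ 2) mulrC ltr_pM2l // exprn_gt0.
Qed.

Lemma cubic_form_gt0 (R : realFieldType) (u v : R) :
  0 <= v -> v ^+ 2 < u ^+ 3 -> 0 < 2 * u ^+ 3 - 3 * u * v + v.
Proof.
move=> v0 vu.
have u3 : 0 < u ^+ 3 := le_lt_trans (sqr_ge0 v) vu.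
have [small|big] := leP (3 * u) 1; first nra.
rewrite ltNge; apply/negP => hf.
have cross : 2 * u ^+ 3 <= v * (3 * u - 1) by lra.
have cross_sq : (2 * u ^+ 3) ^+ 2 <= (v * (3 * u - 1)) ^+ 2.
  by rewrite !expr2; apply: ler_pM => //; rewrite mulr_ge0 // ltW.
have cross_lt : v ^+ 2 * (3 * u - 1) ^+ 2 < u ^+ 3 * (3 * u - 1) ^+ 2.
  by rewrite ltr_pM2r // exprn_gt0 // subr_gt0.
(* cross_sq and cross_lt give 4u^3 < (3u - 1)^2, but (3u - 1)^2 - 4u^3 = -(u - 1)^2 (4u - 1). *)
have : 0 <= (u - 1) ^+ 2 * (4 * u - 1) by rewrite mulr_ge0 ?sqr_ge0 //; lra.
nra.
Qed.

Theorem proposition2 (R : realFieldType) (Q : nat) (pi : 'I_Q -> R)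
    (alpha beta : R)
    (hQ : (1 <= Q)%N)
    (hpi_pos : forall q, 0 < pi q)
    (hpi_sum : \sum_(q < Q) pi q = 1)
    (ha : 0 <= alpha <= 1) (hb : 0 <= beta <= 1)
    (hab : alpha != beta) :
  2 * mom1 pi alpha beta ^+ 3
    - 3 * mom1 pi alpha beta * mom2 pi alpha beta
    + mom3 pi alpha beta = 0
  <-> Q = 1%N.
Proof.
rewrite affiliation_moment_identity //; split=> [|Q1]; last first.
  by subst Q; rewrite big_ord1 in hpi_sum; rewrite !big_ord1 hpi_sum; ring.
move/eqP; rewrite mulf_eq0 expf_eq0 subr_eq0 (negbTE hab) andbF /= => /eqP f0.
apply/eqP; rewrite eqn_leq hQ andbT leqNgt; apply/negP => Q_gt1.
have s3_ge0 : 0 <= \sum_(q < Q) pi q ^+ 3.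
  by rewrite sumr_ge0 // => q _; rewrite exprn_ge0 ?ltW.
have s3_lt : (\sum_(q < Q) pi q ^+ 3) ^+ 2 < (\sum_(q < Q) pi q ^+ 2) ^+ 3.
  by apply: sum_cube_sqr_lt => //; rewrite card_ord.
by have := cubic_form_gt0 s3_ge0 s3_lt; rewrite f0 ltxx.
Qed.
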